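(* Let $f:\mathbb{R}^n\to\mathbb{R}^n$ be locally Lipschitz, and let $V_1,V_2\in C^1(\mathbb{R}^n)$, continuous $N_1,N_2:\mathbb{R}^n\to[0,\infty)$, and continuous $h:[0,\infty)\to[0,\infty)$ with $h(0)=0$ and $\sup_{r>0}h(r)/r<\infty$ satisfy $\nabla V_1\cdot f\le -N_1$ and $\nabla V_2\cdot f\le -N_2+h(N_1)$ on $\mathbb{R}^n$. Let $E:=\{x\in\mathbb{R}^n:N_1(x)=0,\ N_2(x)=0\}$. Let $x(\cdot)$ be a bounded solution defined on $[0,\infty)$ such that $t\mapsto N_i(x(t))$ is uniformly continuous on $[0,\infty)$ for $i=1,2$. Then $\operatorname{dist}(x(t),E)\to0$ as $t\to\infty$.
   Context: $\operatorname{dist}(x,E)=\inf_{e\in E}\|x-e\|$. *)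

(* Defs.v *)
From HB Require Import structures.
From mathcomp Require Import all_boot all_order all_algebra.
From mathcomp Require Import all_classical all_reals all_analysis.
Set Implicit Arguments. Unset Strict Implicit. Unset Printing Implicit Defensive.
Import Order.TTheory GRing.Theory Num.Theory.
Import numFieldNormedType.Exports.
Local Open Scope classical_set_scope.
Local Open Scope ring_scope.

Definition partial {R : realType} {n : nat} (V : 'rV[R]_n -> R) (i : 'I_n)
  (x : 'rV[R]_n) : R := 'D_(delta_mx 0 i) V x.

Definition C1 {R : realType} {n : nat} (V : 'rV[R]_n -> R) : Prop :=
  (forall (i : 'I_n) (x : 'rV[R]_n), derivable V x (delta_mx 0 i)) /\
  (forall i : 'I_n, continuous (partial V i)).

Definition grad_dot {R : realType} {n : nat} (V : 'rV[R]_n -> R)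
  (x v : 'rV[R]_n) : R := \sum_(i < n) partial V i x * v 0 i.

Definition locally_lipschitz {R : realType} {n : nat}
  (f : 'rV[R]_n -> 'rV[R]_n) : Prop :=
  forall x : 'rV[R]_n, exists r : R, exists L : R, 0 < r /\
    forall y z, `|y - x| < r -> `|z - x| < r -> `|f y - f z| <= L * `|y - z|.

Definition is_solution_on_nonneg {R : realType} {n : nat}
  (f : 'rV[R]_n -> 'rV[R]_n) (x : R -> 'rV[R]_n) : Prop :=
  {within `[0, +oo[, continuous x} /\
  (forall t : R, 0 < t -> derivable x t 1 /\ 'D_1 x t = f (x t)).

(* dist(y, E) = inf_{e in E} |y - e|, in the extended reals (= +oo if E empty) *)
Definition dist {R : realType} {n : nat} (y : 'rV[R]_n) (E : set 'rV[R]_n)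
  : \bar R := ereal_inf [set (`|y - e|)%:E | e in E].

(* Main.v *)
Require Import Defs.
From HB Require Import structures.
From mathcomp Require Import all_boot all_order all_algebra.
From mathcomp Require Import all_classical all_reals all_analysis.
From mathcomp Require Import lra.
Import Order.TTheory GRing.Theory Num.Theory.
Import numFieldNormedType.Exports.
Local Open Scope classical_set_scope.
Local Open Scope ring_scope.

(** Along the solution, [W = V2 + (|C| + 1) V1] is bounded below and
    satisfies [W' <= - (N1 + N2)], because [h r <= |C| r]. Being nonincreasing,
    [W] eventually varies by less than any prescribed amount; uniform continuity
    of [N1 + N2] along the solution then forces [N1 + N2 --> 0] (Barbalat).
    Boundedness of the orbit and compactness turn this into convergence to the
    common zero set. *)

(** * Max norm on row vectors and compactness of closed balls *)

Lemma rV_norm_le {R : realType} {n : nat} (v : 'rV[R]_n) (b : R) :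
  0 <= b -> (forall i, `|v 0 i| <= b) -> `|v| <= b.
Proof.
move=> b0 vb; rewrite [leLHS]/Num.norm /= mx_normrE.
by apply: bigmax_le => // -[i j] _ /=; rewrite (ord1 i).
Qed.

Lemma rV_norm_ge_coord {R : realType} {n : nat} (v : 'rV[R]_n) (i : 'I_n) :
  `|v 0 i| <= `|v|.
Proof.
rewrite [leRHS]/Num.norm /= mx_normrE.
by apply: (le_bigmax _ (fun ij => `|v ij.1 ij.2|) (0, i)).
Qed.

Lemma compact_norm_le {R : realType} {n : nat} (M : R) :
  compact [set y : 'rV[R]_n | `|y| <= M].
Proof.
apply: bounded_closed_compact.
  by exists M; split=> [|M' MM' y /= yM]; [exact: num_real|lra].
have nc : continuous (fun y : 'rV[R]_n => `|y|) by move=> y; exact: norm_continuous.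
exact: (preimage_closed (in1W nc) (@closed_le _ M)).
Qed.

(** * Differentiability of [C1] functions and the chain rule *)

Lemma is_derive_line {R : realType} {n : nat} (V : 'rV[R]_n -> R) (z e : 'rV[R]_n)
    (u : R) :
  derivable V (z + u *: e) e ->
  is_derive u 1 (fun s => V (z + s *: e)) ('D_e V (z + u *: e)).
Proof.
move=> dV.
have E : (fun h : R =>
         h^-1 *: (((fun s => V (z + s *: e)) \o shift u) (h *: 1) - V (z + u *: e)))
       = (fun h : R => h^-1 *: ((V \o shift (z + u *: e)) (h *: e) - V (z + u *: e))).
  apply/funext => h /=; congr (_ *: (V _ - _)).
  by rewrite [h *: 1]mulr1 scalerDl addrCA.
by split; [rewrite /derivable E|rewrite /derive E].
Qed.

(** One-variable mean value theorem on a coordinate line. The form [|c| <= |s|] covers both signs of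
    [s] and keeps the intermediate point close to [z]. *)
Lemma partial_MVT {R : realType} {n : nat} (V : 'rV[R]_n -> R) (i : 'I_n) (z : 'rV[R]_n)
    (s : R) :
  (forall y, derivable V y (delta_mx 0 i)) ->
  exists2 c, `|c| <= `|s| &
    V (z + s *: delta_mx 0 i) - V z = partial V i (z + c *: delta_mx 0 i) * s.
Proof.
move=> dV; pose g (u : R) := V (z + u *: delta_mx 0 i).
have dg (u : R) : is_derive u 1 g (partial V i (z + u *: delta_mx 0 i)).
  by apply: is_derive_line.
have cg A : {within A, continuous g}.
  apply: continuous_subspaceT => u.
  by apply: differentiable_continuous; apply/derivable1_diffP.
have -> : V z = g 0 by rewrite /g scale0r addr0.
have [s0|s0] := leP 0 s.
- have [c /[!in_itv]/= /andP[c0 cs] E] := MVT_segment s0 (fun u _ => dg u) (cg _).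
  by exists c; rewrite ?ger0_norm// -/(g s) E subr0.
- have [c /[!in_itv]/= /andP[c0 cs] E] := MVT_segment (ltW s0) (fun u _ => dg u) (cg _).
  exists c; first by rewrite !ler0_norm ?lerN2// ltW.
  by rewrite -/(g s) -opprB E sub0r mulrN opprK.
Qed.

Lemma grad_dot_linear {R : realType} {n : nat} (V : 'rV[R]_n -> R) (y : 'rV[R]_n) :
  linear (grad_dot V y : 'rV[R]_n -> R^o).
Proof.
move=> a u v; rewrite /grad_dot scaler_sumr -big_split /=; apply: eq_bigr => i _.
by rewrite !mxE mulrDr mulrCA.
Qed.

HB.instance Definition _ (R : realType) (n : nat) (V : 'rV[R]_n -> R) (y : 'rV[R]_n) :=
  GRing.isLinear.Build R 'rV[R]_n R^o *:%R (grad_dot V y) (grad_dot_linear V y).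

Lemma grad_dot_continuous {R : realType} {n : nat} (V : 'rV[R]_n -> R) (y : 'rV[R]_n) :
  continuous (grad_dot V y).
Proof.
apply: continuous_big => [|i _ v]; first exact: add_continuous.
exact: (@cvgMl_tmp _ _ (nbhs v) _ _ _ _ (@coord_continuous R 1 n 0 i v)).
Qed.

(** The increment of [V] splits into coordinate steps. Each is a partial derivative at a point near
    [y] times [v 0 i], and continuity of the partials lets it be replaced by its value at [y]. *)
Lemma C1_first_order {R : realType} {n : nat} (V : 'rV[R]_n -> R) (y : 'rV[R]_n) (e : R) :
  C1 V -> 0 < e ->
  \forall v \near (0 : 'rV[R]_n), `|V (v + y) - (V y + grad_dot V y v)| <= e * `|v|.
Proof.
move=> [dV cV] e0; have n0 : 0 < n.+1%:R :> R by rewrite ltr0n.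
(* The tolerance is shared among the [n] coordinates; [n.+1] keeps the divisor nonzero when [n] is
   0. *)
have e'0 : 0 < e / n.+1%:R by rewrite divr_gt0.
have : \forall w \near y, forall i, `|partial V i y - partial V i w| < e / n.+1%:R.
  apply: (@filter_forall _ _ _ (nbhs y)) => i.
  by have /cvgrPdist_lt/(_ _ e'0) := cV i y.
move=> /nbhs_normP[d /= d0 Hd]; apply/nbhs_normP; exists d => //= v /=.
rewrite sub0r normrN => vd.
pose P k := \row_j (if (j < k)%N then v 0 j else 0).
(* Move from [y] to [y + v] one coordinate at a time. *)
have -> : V (v + y) - (V y + grad_dot V y v) =
    \sum_(i < n) (V (y + P i.+1) - V (y + P i) - partial V i y * v 0 i).
  rewrite sumrB -(big_mkord xpredT (fun i => V (y + P i.+1) - V (y + P i))).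
  rewrite (telescope_sumr (fun i => V (y + P i)))// opprD addrA.
  have -> : P n = v by apply/rowP => j; rewrite mxE ltn_ord.
  have -> : P 0%N = 0 by apply/rowP => j; rewrite !mxE.
  by rewrite addr0 [v + y]addrC.
apply: le_trans (ler_norm_sum _ _ _) _.
apply: (@le_trans _ _ (\sum_(i < n) (e / n.+1%:R * `|v|))); last first.
  rewrite sumr_const card_ord -[leLHS]mulr_natl mulrA ler_wpM2r// mulrCA
    ler_piMr ?(ltW e0)//.
  by rewrite ler_pdivrMr// mul1r ler_nat.
apply: ler_sum => i _.
have -> : P i.+1 = P i + v 0 i *: delta_mx 0 i.
  apply/rowP => j; rewrite !mxE eqxx /= ltnS leq_eqVlt.
  have [->|ji] := eqVneq j i; first by rewrite eqxx ltnn /= add0r mulr1.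
  have -> : ((j : nat) == i) = false by apply/negbTE.
  by rewrite /= mulr0 addr0.
rewrite addrA; have [c cv ->] := partial_MVT V i (y + P i) (v 0 i) (dV i).
(* The intermediate point differs from [y] by a vector with every coordinate at most [|v|], so in
   the max norm it stays in the ball of radius [d]. *)
rewrite -mulrBl normrM ler_pM// ?rV_norm_ge_coord// distrC ltW// Hd//=.
rewrite -addrA opprD addrA subrr sub0r normrN (le_lt_trans _ vd)//.
apply: rV_norm_le => // j; rewrite !mxE eqxx /=.
have [->|ji] := eqVneq j i.
  by rewrite ltnn add0r mulr1 (le_trans cv)// rV_norm_ge_coord.
rewrite mulr0 addr0; case: ifP => _; first exact: rV_norm_ge_coord.
by rewrite normr0.
Qed.

(** The first-order estimate is the little-o expansion characterising the differential, and
    uniqueness identifies it with the gradient form. *)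
Lemma C1_differentiable {R : realType} {n : nat} (V : 'rV[R]_n -> R) (y : 'rV[R]_n) :
  C1 V -> differentiable V y /\ 'd V y = grad_dot V y :> (_ -> _).
Proof.
move=> CV.
pose W : 'rV[R]_n -> R^o := V.
pose L : {linear 'rV[R]_n -> R^o} := grad_dot V y.
have cL : continuous L by exact: grad_dot_continuous.
have H : W \o shift y = cst (W y) + L +o_ (0 : 'rV[R]_n) id.
  by apply/eqaddoP => e e0; exact: C1_first_order.
have E := diff_unique cL H.
by split=> //; apply/diff_locallyP; rewrite E; split.
Qed.

Lemma C1_continuous {R : realType} {n : nat} (V : 'rV[R]_n -> R) :
  C1 V -> continuous V.
Proof.
by move=> CV y; apply: differentiable_continuous; have [] := C1_differentiable V y CV.
Qed.

Lemma C1_chain_rule {R : realType} {n : nat} (V : 'rV[R]_n -> R) (x : R -> 'rV[R]_n)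
    (t : R) :
  C1 V -> derivable x t 1 ->
  is_derive t 1 (V \o x) (grad_dot V (x t) ('D_1 x t)).
Proof.
move=> CV /derivable1_diffP dx; have [dV EV] := C1_differentiable V (x t) CV.
have dVx : differentiable (V \o x) t by apply: differentiable_comp.
split; first exact/derivable1_diffP.
by rewrite deriveE// diff_comp//= EV deriveE.
Qed.

(** * Asymptotics: decay of the dissipation rate and distance to its zero set *)

Lemma decay_rate_cvg0 {R : realType} (v dv g : R -> R) (m : R) :
  (forall t : R, 0 < t -> is_derive t 1 v (dv t)) ->
  (forall t, 0 < t -> dv t <= - g t) ->
  (forall t, 0 <= t -> 0 <= g t) ->
  (forall t, 0 < t -> m <= v t) ->
  (forall e : R, 0 < e -> exists d : R, 0 < d /\ forall s t : R, 0 <= s -> 0 <= t ->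
      `|s - t| < d -> `|g s - g t| < e) ->
  forall e : R, 0 < e -> \forall t \near +oo, g t < e.
Proof.
move=> dvP dvg g0 mv ug e e0.
have mvt (a b : R) : 0 < a -> a <= b ->
    exists2 c, a <= c <= b & v b - v a = dv c * (b - a).
  move=> a0 ab.
  have d (t : R) : t \in `]a, b[ -> is_derive t 1 v (dv t).
    by rewrite in_itv /= => /andP[at_ _]; apply: dvP; lra.
  have [|c /[!in_itv] cab E] := MVT_segment ab d; last by exists c.
  apply: derivable_within_continuous => t /[!in_itv]/= /andP[at_ _].
  by have [] := dvP t (lt_le_trans a0 at_).
pose A := [set v t | t in [set t : R | 0 < t]].
have Alb : has_lbound A by exists m => _ [t t0 <-]; exact: mv.
have Ai : has_inf A by split=> //; exists (v 1), 1 => //=; exact: ltr01.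
have [d [d0 dP]] := ug (e / 2) ltac:(lra).
(* If [g t >= e], then [g > e / 2] on [[t, t + d / 2]], so [v] drops there by more than this amount.
   Past [T], where [v] is within this amount of its infimum, that is impossible. *)
have ed : 0 < e / 2 * (d / 2) by rewrite mulr_gt0 ?divr_gt0.
have [_ [T /= T0 <-] vT] := inf_adherent ed Ai.
near=> t; rewrite ltNge; apply/negP => get.
have Tt : T <= t by near: t; exact: nbhs_pinfty_ge (num_real _).
have vtT : v t <= v T.
  have [c /andP[c1 c2] E] := mvt T t T0 Tt.
  have := dvg c ltac:(lra); have := g0 c ltac:(lra); nra.
have [c /andP[c1 c2] E] := mvt t (t + d / 2) ltac:(lra) ltac:(lra).
have : `|c - t| < d by rewrite ger0_norm; lra.
move=> /(dP c t ltac:(lra) ltac:(lra)); rewrite ltr_norml => /andP[gc _].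
have := dvg c ltac:(lra).
have : inf A <= v (t + d / 2) by apply: ge_inf => //; exists (t + d / 2) => //=; lra.
nra.
Unshelve. all: by end_near. Qed.

(** On the compact set [K] of points of the ball at distance at least [e] from every zero, [N] has a
    positive minimum. Once [N (x t)] is below it, [x t] has left [K]. That zeros exist is part of
    the outcome. *)
Lemma dist_zeros_cvg0 {R : realType} {n : nat} (N : 'rV[R]_n -> R)
  (x : R -> 'rV[R]_n) (M : R) :
  continuous N -> (forall y, 0 <= N y) ->
  (forall t, 0 <= t -> `|x t| <= M) ->
  (forall e, 0 < e -> \forall t \near +oo, N (x t) < e) ->
  dist (x t) [set y | N y = 0] @[t --> +oo] --> 0%E.
Proof.
move=> cN N0 xM Nx.
have H e : 0 < e -> \forall t \near +oo, exists2 z, N z = 0 & `|x t - z| < e.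
  move=> e0.
  pose K := [set y : 'rV[R]_n | `|y| <= M] `&`
            \bigcap_(z in [set z | N z = 0]) [set y | e <= `|y - z|].
  have cK : compact K.
    apply: compact_closedI; first exact: compact_norm_le.
    have nc : continuous (fun y : 'rV[R]_n => `|y|).
      by move=> y; exact: norm_continuous.
    have zc z : continuous (fun y : 'rV[R]_n => `|y - z|).
      have sc : continuous (fun y : 'rV[R]_n => y - z).
        by move=> y; exact: (cvgB (@cvg_id _ (nbhs y)) (@cvg_cst _ z _ (nbhs y) _)).
      by move=> y; exact: (@continuous_comp _ _ _ _ _ y (sc y) (nc _)).
    by apply: closed_bigI => z _; exact: (preimage_closed (in1W (zc z)) (@closed_ge _ e)).
  have xK t : 0 <= t -> ~ (exists2 z, N z = 0 & `|x t - z| < e) -> K (x t).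
    move=> t0 Hn; split; first exact: xM.
    move=> z /= Nz; rewrite leNgt; apply/negP => xz; apply: Hn; by exists z.
  have [K0|K0] := pselect (K !=set0); last first.
    near=> t; have t0 : 0 <= t by near: t; exact: nbhs_pinfty_ge (num_real _).
    by apply: contrapT => Hn; apply: K0; exists (x t); exact: xK.
  have [c /[!inE] -[_ cK2] Nc] := EVT_min_rV K0 cK (continuous_subspaceT cN).
  (* A zero in [K] would be at distance at least [e] from itself. *)
  have Nc0 : 0 < N c.
    rewrite lt0r N0 andbT; apply/eqP => /(cK2 c) /=.
    by rewrite subrr normr0; lra.
  near=> t; have t0 : 0 <= t by near: t; exact: nbhs_pinfty_ge (num_real _).
  have Nt : N (x t) < N c by near: t; exact: Nx.
  apply: contrapT => Hn; have := Nc (x t); rewrite inE => /(_ (xK t t0 Hn)); lra.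
have D0 y E : (0 <= dist y E)%E by apply: le_ereal_inf_tmp => _ [z _ <-]; rewrite lee_fin.
have De e : 0 < e -> \forall t \near +oo, (dist (x t) [set y | N y = 0%R] <= e%:E)%E.
  move=> /H; apply: filterS => t [z Nz xz].
  apply: (@le_trans _ _ (`|x t - z|)%:E); last by rewrite lee_fin ltW.
  by apply: ereal_inf_lbound; exists z.
(* The distance is an extended real: the bound by 1 first makes it eventually finite, then real
   convergence applies. *)
apply/fine_cvgP; split.
  have := De 1 ltr01; apply: filterS => t Ht.
  by rewrite ge0_fin_numE ?D0// (le_lt_trans Ht)// ltry.
apply/cvgrPdist_le => e /De; apply: filterS => t Ht.
rewrite sub0r normrN ger0_norm ?fine_ge0 ?D0// -lee_fin fineK//.
by rewrite ge0_fin_numE ?D0// (le_lt_trans Ht)// ltry.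
Unshelve. all: by end_near. Qed.

(** * Combining the two Lyapunov functions *)

Theorem theorem2p4 (R : realType) (n : nat)
  (f : 'rV[R]_n -> 'rV[R]_n) (V1 V2 N1 N2 : 'rV[R]_n -> R) (h : R -> R)
  (x : R -> 'rV[R]_n) :
  locally_lipschitz f ->
  C1 V1 -> C1 V2 ->
  continuous N1 -> continuous N2 ->
  (forall y, 0 <= N1 y) -> (forall y, 0 <= N2 y) ->
  {within `[0, +oo[, continuous h} ->
  (forall r, 0 <= r -> 0 <= h r) ->
  h 0 = 0 ->
  (exists C : R, forall r, 0 < r -> h r / r <= C) ->
  (forall y, grad_dot V1 y (f y) <= - N1 y) ->
  (forall y, grad_dot V2 y (f y) <= - N2 y + h (N1 y)) ->
  is_solution_on_nonneg f x ->
  (exists M : R, forall t, 0 <= t -> `|x t| <= M) ->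
  (forall e : R, 0 < e -> exists d : R, 0 < d /\ forall s t : R, 0 <= s -> 0 <= t ->
      `|s - t| < d -> `|N1 (x s) - N1 (x t)| < e) ->
  (forall e : R, 0 < e -> exists d : R, 0 < d /\ forall s t : R, 0 <= s -> 0 <= t ->
      `|s - t| < d -> `|N2 (x s) - N2 (x t)| < e) ->
  dist (x t) [set y | N1 y = 0 /\ N2 y = 0] @[t --> +oo] --> 0%E.
Proof.
move=> _ CV1 CV2 cN1 cN2 N10 N20 _ _ h0 [C hC] dV1 dV2 [_ xf] [M xM] uN1 uN2.
(* The absolute value makes the slope nonnegative, as needed for the weight [c] below; at [r = 0]
   the bound comes from [h 0 = 0]. *)
have hle r : 0 <= r -> h r <= `|C| * r.
  rewrite le_eqVlt => /orP[/eqP<-|r0]; first by rewrite h0 mulr0.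
  by rewrite -ler_pdivrMr// (le_trans (hC r r0))// ler_norm.
pose N y := N1 y + N2 y.
have N0 y : 0 <= N y by rewrite addr_ge0.
have -> : [set y | N1 y = 0 /\ N2 y = 0] = [set y | N y = 0].
  apply/seteqP; split=> y /=; rewrite /N; first by case=> -> ->; rewrite addr0.
  by move=> NE; have := N10 y; have := N20 y; split; lra.
have cN : continuous N by move=> y; exact: (cvgD (cN1 y) (cN2 y)).
apply: (dist_zeros_cvg0 _ _ M) => //.
(* In the weight of [V1], the part [|C|] absorbs [h (N1 y)] and the extra 1 leaves [- N1 y]. *)
pose c := `|C| + 1; pose W y := V2 y + c * V1 y.
pose dW y := grad_dot V2 y (f y) + c * grad_dot V1 y (f y).
have dWN y : dW y <= - N y.
  rewrite /dW /N /c; have := dV1 y; have := dV2 y; have := hle _ (N10 y).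
  by have := normr_ge0 C; nra.
have cW : continuous W.
  by move=> y; exact: (cvgD (C1_continuous V2 CV2 y)
    (cvgMl_tmp (C1_continuous V1 CV1 y))).
(* The lower bound is the minimum of [W] over the closed ball containing the orbit. *)
have [m Wm] : exists m, forall y, `|y| <= M -> m <= W y.
  have B0 : [set y : 'rV[R]_n | `|y| <= M] !=set0 by exists (x 0); exact: xM.
  have [y _ Wy] := EVT_min_rV B0 (compact_norm_le M) (continuous_subspaceT cW).
  by exists (W y) => z zM; apply: Wy; rewrite inE.
apply: (decay_rate_cvg0 (W \o x) (dW \o x) (N \o x) m).
- move=> t t0; have [xd xE] := xf t t0.
  have := C1_chain_rule V1 x t CV1 xd; have := C1_chain_rule V2 x t CV2 xd.
  rewrite xE => d2 d1.
  exact: (is_deriveD d2 (is_deriveZ c d1)).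
- by move=> t _; exact: dWN.
- by move=> t _; exact: N0.
- by move=> t t0; apply: Wm; apply: xM; exact: ltW.
move=> e e0; have [d1 [d10 u1]] := uN1 (e / 2) ltac:(lra).
have [d2 [d20 u2]] := uN2 (e / 2) ltac:(lra).
exists (Num.min d1 d2); split=> [|s t s0 t0]; first by rewrite lt_min d10.
rewrite lt_min => /andP[/(u1 s t s0 t0) + /(u2 s t s0 t0)].
by rewrite /N /= !ltr_norml; lra.
Qed.
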